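(* Let $n\geq 3$ and let $A=[a_{ij}]$ be an $n\times n$ reciprocal matrix. Let $w=[w_1,\ldots,w_n]^T$ be the Perron eigenvector of $A$, and let $G_{A,w}=(V,E)$ be the digraph associated with $A$ and $w$. Let $i\in V$ and suppose there is $k\in\{1,\ldots,n\}\setminus\{i\}$ such that $(k,i)\notin E$. Then there is $j\in V$ such that $(j,i)\in E$ and $(i,j)\notin E$.
   Context: An $n\times n$ real matrix $A=[a_{ij}]$ with positive entries is reciprocal if $a_{ij}=1/a_{ji}$ for all $i,j$ (so $a_{ii}=1$). The Perron eigenvector of $A$ is the (positive) eigenvector associated with the largest eigenvalue (the Perron eigenvalue) of $A$, normalized to have first component equal to $1$. For a positive vector $w=[w_1,\ldots,w_n]^T$, the digraph $G_{A,w}$ has vertex set $V=\{1,\ldots,n\}$ and edge set $E=\{(i,j): i\neq j,\ w_i/w_j\geq a_{ij}\}$. *)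

(* Defs.v *)
From HB Require Import structures.
From mathcomp Require Import all_boot all_order all_algebra.
From mathcomp Require Import reals complex.

Set Implicit Arguments.
Unset Strict Implicit.
Unset Printing Implicit Defensive.

Import Order.TTheory GRing.Theory Num.Theory.

Local Open Scope ring_scope.
Local Open Scope complex_scope.

Definition reciprocal (R : realType) (n : nat) (A : 'M[R]_n) : Prop :=
  (forall i j, 0 < A i j) /\ (forall i j, A i j = (A j i)^-1).

(* A real square matrix may have nonreal eigenvalues: "largest" means of
   largest modulus among all complex eigenvalues. MathComp's [eigenvalue] is
   phrased with row vectors; a square matrix and its transpose have the same
   eigenvalues. *)
Definition perron_eigenvalue (R : realType) (n : nat) (A : 'M[R]_n) (r : R) :
    Prop :=
  eigenvalue A r /\
  (forall mu : R[i],
     eigenvalue (map_mx (real_complex R) A) mu -> `|mu| <= r%:C).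

(* Right (column) eigenvector; the index of value 0 is the first one. *)
Definition perron_eigenvector (R : realType) (n : nat) (A : 'M[R]_n)
    (w : 'cV[R]_n) : Prop :=
  [/\ exists2 r : R, perron_eigenvalue A r & A *m w = r *: w,
      forall i, 0 < w i 0
    & forall i : 'I_n, i = 0%N :> nat -> w i 0 = 1].

Definition digraph_edges (R : realType) (n : nat) (A : 'M[R]_n)
    (w : 'cV[R]_n) : {set 'I_n * 'I_n} :=
  [set e | (e.1 != e.2) && (w e.1 0 / w e.2 0 >= A e.1 e.2)].

(* Main.v *)
Require Import Defs.
From mathcomp Require Import all_boot all_order all_algebra.
From mathcomp Require Import reals complex.
From mathcomp Require Import ring.

(** Rescaling [A] by [w] gives the reciprocal matrix
    [b_ij = a_ij w_j / w_i], all of whose row sums equal the Perron eigenvalue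
    [r], and [(i, j)] is an edge iff [b_ij <= 1]. As [b_ij + b_ji >= 2], the
    entries of [b] sum to at least [n^2], so [r >= n]. Row [i] has the entry
    [b_ik < 1], hence it must also have an entry [b_ij > 1]. *)

Import Order.TTheory GRing.Theory Num.Theory.
Local Open Scope ring_scope.

Lemma ler2_addV (R : realFieldType) (x : R) : 0 < x -> 2 <= x + x^-1.
Proof.
move=> x_gt0; rewrite -subr_ge0.
have -> : x + x^-1 - 2 = (x - 1) ^+ 2 / x by field; rewrite gt_eqF.
by rewrite divr_ge0 ?sqr_ge0 ?ltW.
Qed.

(** Doubling the sum pairs each entry with its transpose, so every term has the form [x + x^-1], the
    diagonal included. *)
Lemma reciprocal_sum_ge (R : realType) (n : nat) (B : 'M[R]_n) :
  reciprocal B -> n%:R * n%:R <= \sum_i \sum_j B i j.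
Proof.
move=> [B_gt0 BV]; rewrite -(ler_pM2l (ltr0n R 2)).
have -> : 2 * (\sum_i \sum_j B i j) = \sum_i \sum_j (B i j + B j i).
  under [RHS]eq_bigr do rewrite big_split.
  by rewrite big_split /= [X in _ = _ + X]exchange_big /= mulr_natl mulr2n.
have -> : 2 * (n%:R * n%:R) = \sum_(i < n) \sum_(j < n) 2 :> R.
  by rewrite !sumr_const !card_ord -mulrnA -[RHS]mulr_natr natrM.
by apply: ler_sum => u _; apply: ler_sum => v _; rewrite (BV v u) ler2_addV.
Qed.

Theorem theorem2 (R : realType) (n : nat) (hn : (3 <= n)%N)
    (A : 'M[R]_n) (hA : reciprocal A)
    (w : 'cV[R]_n) (hw : perron_eigenvector A w)
    (i : 'I_n)
    (hi : exists k : 'I_n, k != i /\ (k, i) \notin digraph_edges A w) :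
  exists j : 'I_n,
    (j, i) \in digraph_edges A w /\ (i, j) \notin digraph_edges A w.
Proof.
case: hA hw hi => A_gt0 AV [[r _ Aw] w_gt0 _] [k [k_neq_i]].
have w_neq0 u : w u 0 != 0 by rewrite gt_eqF.
pose B := \matrix_(u, v) (A u v * w v 0 / w u 0).
have B_gt0 u v : 0 < B u v by rewrite mxE divr_gt0 ?mulr_gt0.
have BV u v : B u v = (B v u)^-1.
  by rewrite !mxE AV; field; rewrite !w_neq0 gt_eqF.
have edgeE u v : ((u, v) \in digraph_edges A w) = (u != v) && (B u v <= 1).
  by rewrite inE /= mxE ler_pdivlMr // ler_pdivrMr // mul1r.
have row_sum u : \sum_v B u v = r.
  under eq_bigr do rewrite mxE.
  move/matrixP/(_ u 0): Aw; rewrite !mxE -mulr_suml => ->.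
  by rewrite mulfK.
(* The [n] rows of [B] each sum to [r], so its entries total [n * r], which is at least [n * n];
   cancel [n]. *)
have n_le_r : n%:R <= r.
  have n_gt0 : 0 < n%:R :> R by rewrite ltr0n; apply: leq_trans hn.
  rewrite -(ler_pM2l n_gt0); apply: le_trans (reciprocal_sum_ge _ _ B (conj B_gt0 BV)) _.
  by under eq_bigr do rewrite row_sum; rewrite sumr_const card_ord mulr_natl.
rewrite edgeE k_neq_i /= -ltNge => Bki_gt1.
have Bik_lt1 : B i k < 1 by rewrite BV invf_lt1.
have [/existsP[j Bij_gt1]|/existsPn B_le1] := boolP [exists j, 1 < B i j].
  (* A diagonal entry is its own inverse, so it cannot exceed 1. *)
  have j_neq_i : j != i.
    apply: contraTneq Bij_gt1 => ->; apply/negP => Bii_gt1.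
    by have := Bii_gt1; rewrite BV invf_gt1 // => /(lt_trans Bii_gt1); rewrite ltxx.
  exists j; rewrite !edgeE j_neq_i eq_sym j_neq_i /= -ltNge; split=> //.
  by rewrite BV invf_le1 // ltW.
(* If no entry of row [i] exceeds 1, the entry at [k], being below 1, pulls the row sum strictly
   under [n], against [n <= r]. *)
have : \sum_v B i v < n%:R.
  rewrite -[n in n%:R]card_ord -sumr_const (bigD1 k) //= [ltRHS](bigD1 k) //=.
  by apply: ltr_leD => //; apply: ler_sum => v _; rewrite leNgt B_le1.
by rewrite row_sum ltNge n_le_r.
Qed.
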